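(* Let $\Lambda\subseteq\Theta_n$ be an index set of cardinality $m>0$ with real root matrix $Y$. Let $T\subseteq\mathbb Z_2^m$, let $p$ be a positive rational number, and let $\mathbf a_0\in(\mathbb R_{>0})^m$. Let $$\Delta_{\mathbf a_0}=\{\mathbf a_0+\mathbf w : \mathbf w\in\operatorname{Null}(Y^T)\}\cap(\mathbb R_{>0})^m,\qquad \Delta^p_{\mathbf a_0}=\{(a_1^p,\dots,a_m^p) : (a_1,\dots,a_m)\in\Delta_{\mathbf a_0}\},$$ $$\Sigma(T,\Delta^p_{\mathbf a_0})=\{\mathbf t\bullet\mathbf x : \mathbf t\in T,\ \mathbf x\in\Delta^p_{\mathbf a_0}\}\subseteq\mathbb R^m.$$ Then $\Sigma(T,\Delta^p_{\mathbf a_0})$ is a semi-algebraic subset of $\mathbb R^m$ with compact closure.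
   Context: $[n]=\{1,\dots,n\}$ and $\Theta_n=\{(i,j,k)\in[n]^3 : i<j<k\}$, with a fixed ordering. The real root matrix $Y$ of $\Lambda$ is the $m\times n$ real matrix whose rows are the vectors $\mathbf e_i^T+\mathbf e_j^T-\mathbf e_k^T$, $(i,j,k)\in\Lambda$, listed in the fixed order, where $\mathbf e_1,\dots,\mathbf e_n$ is the standard basis. $\mathbb Z_2^m=\{0,1\}^m$ acts on $\mathbb R^m$ by $(s_1,\dots,s_m)\bullet(a_1,\dots,a_m)=((-1)^{s_1}a_1,\dots,(-1)^{s_m}a_m)$. A semi-algebraic subset of $\mathbb R^m$ is one obtained from sets defined by finitely many polynomial equations and inequalities by finite unions and intersections. *)

(* Defs.v *)
From mathcomp Require Import all_boot all_order all_algebra.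
From mathcomp Require Import all_classical all_reals all_analysis.
(* Required but not imported: the notations of mpoly clash with those of
   mathcomp-analysis. *)
From mathcomp Require mpoly.

Set Implicit Arguments.
Unset Strict Implicit.
Unset Printing Implicit Defensive.

Import Order.TTheory GRing.Theory Num.Theory.
Import numFieldNormedType.Exports.

Local Open Scope classical_set_scope.
Local Open Scope ring_scope.

(* The index set [n] is 'I_n, so indices are numbered from 0. *)

Definition Theta (n : nat) : {set 'I_n * 'I_n * 'I_n} :=
  [set t : 'I_n * 'I_n * 'I_n | (t.1.1 < t.1.2)%N & (t.1.2 < t.2)%N]%SET.

(* A linear ordering of Theta n, given as a duplicate-free enumeration. *)
Definition is_ordering (n : nat) (ord : seq ('I_n * 'I_n * 'I_n)) : Prop :=
  uniq ord /\ ord =i Theta n.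

Definition root_vector (R : realType) (n : nat)
    (t : 'I_n * 'I_n * 'I_n) : 'rV[R]_n :=
  delta_mx 0 t.1.1 + delta_mx 0 t.1.2 - delta_mx 0 t.2.

(* When Lambda is a subset of Theta n with m elements, the list below has
   exactly m entries, so the default value of nth is never used. *)
Definition root_matrix (R : realType) (n m : nat)
    (ord : seq ('I_n * 'I_n * 'I_n)) (Lambda : {set 'I_n * 'I_n * 'I_n}) :
    'M[R]_(m, n) :=
  \matrix_(i < m) nth 0 [seq root_vector R t | t <- ord & t \in Lambda] i.

Definition positive_orthant (R : realType) (m : nat) : set 'rV[R]_m :=
  [set a : 'rV[R]_m | forall i, 0 < a 0 i].

(* Elements of R^m are row vectors; A acts on them as column vectors. *)
Definition Null (R : realType) (k m : nat) (A : 'M[R]_(k, m)) :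
    set 'rV[R]_m :=
  [set w : 'rV[R]_m | A *m w^T = 0].

Definition Delta (R : realType) (n m : nat) (Y : 'M[R]_(m, n))
    (a0 : 'rV[R]_m) : set 'rV[R]_m :=
  [set a0 + w | w in Null Y^T] `&` @positive_orthant R m.

Definition row_pow (R : realType) (m : nat) (p : rat) (a : 'rV[R]_m) :
    'rV[R]_m :=
  \row_i (a 0 i `^ ratr p).

Definition Delta_pow (R : realType) (n m : nat) (Y : 'M[R]_(m, n))
    (p : rat) (a0 : 'rV[R]_m) : set 'rV[R]_m :=
  [set row_pow p a | a in Delta Y a0].

Definition sign_act (R : realType) (m : nat) (s : 'rV['Z_2]_m)
    (a : 'rV[R]_m) : 'rV[R]_m :=
  \row_i ((-1) ^+ (s 0 i : nat) * a 0 i).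

Definition Sigma (R : realType) (m : nat) (T : set 'rV['Z_2]_m)
    (D : set 'rV[R]_m) : set 'rV[R]_m :=
  [set sign_act t x | t in T & x in D].

(* The solutions of a finite system q = 0 (q in E), q > 0 (q in P),
   q >= 0 (q in N) of polynomial equations and inequalities. *)
Definition basic_semialgebraic (R : realType) (m : nat)
    (E P N : seq (mpoly.mpoly m R)) : set 'rV[R]_m :=
  [set x : 'rV[R]_m | let ev q := mpoly.meval (fun i => x 0 i) q in
    [&& all (fun q => ev q == 0) E,
        all (fun q => 0 < ev q) P &
        all (fun q => 0 <= ev q) N]].

Inductive semialgebraic (R : realType) (m : nat) : set 'rV[R]_m -> Prop :=
| semialgebraic_basic (E P N : seq (mpoly.mpoly m R)) :
    semialgebraic (basic_semialgebraic E P N)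
| semialgebraic_setU (A B : set 'rV[R]_m) :
    semialgebraic A -> semialgebraic B -> semialgebraic (A `|` B)
| semialgebraic_setI (A B : set 'rV[R]_m) :
    semialgebraic A -> semialgebraic B -> semialgebraic (A `&` B).

(* Main.v *)
Require Import Defs.
From mathcomp Require Import all_boot all_order all_algebra.
From mathcomp Require Import all_classical all_reals all_analysis.
From mathcomp Require Import ordered_qelim.
From mathcomp Require mpoly qe_rcf.

Set Implicit Arguments.
Unset Strict Implicit.
Unset Printing Implicit Defensive.

Import Order.TTheory GRing.Theory Num.Theory.
Import numFieldNormedType.Exports.
Import (canonicals) mpoly.
Local Open Scope classical_set_scope.
Local Open Scope ring_scope.

(** Semi-algebraicity.  Write [p = r / s] with positive integers [r] and [s].
    A point of [Delta] has positive coordinates, so each of them is uniquely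
    [y_i ^ s] with [y_i > 0], and its [p]-th power is then [y_i ^ r].  Hence
    [Sigma] is the union, over the finitely many sign vectors [t] in [T], of
    the sets of those [x] for which there is [y] with
      [y_i > 0], [x_i = (-1) ^ t_i * y_i ^ r] and [Y^T (y ^ s - a0) = 0].
    This description is first-order over the reals
    ([sign_act_Delta_powP]), but it has quantifiers.  Tarski's
    quantifier elimination removes them, and a quantifier-free formula
    defines a semi-algebraic set because complements of the atomic conditions
    are finite unions of such conditions; so every first-order definable set is
    semi-algebraic ([semialgebraic_holds]).

    Compactness.  The entries of [e_i + e_j - e_k] sum to 1, that is,
    [Y 1 = 1].  Pairing [Y^T (a - a0) = 0] with the vector [1] shows that all
    points of [Delta] have the same coordinate sum as [a0].  As the coordinates
    are positive, each of them is at most that sum ([Delta_le_sum]), so [Sigma]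
    lies in a cube, which is compact and closed. *)

(** * Semi-algebraic sets *)

Section SemialgebraicSets.
Variables (R : realType) (m : nat).
Implicit Types (A B : set 'rV[R]_m) (q : mpoly.mpoly m R) (x : 'rV[R]_m).

Lemma semialgebraic_ext A B :
  (forall x, A x <-> B x) -> semialgebraic A -> semialgebraic B.
Proof. by move=> AB sA; rewrite (_ : B = A) //; apply/seteqP; split=> x /AB. Qed.

Lemma semialgebraic_zero q : semialgebraic [set x | mpoly.meval (x 0) q == 0].
Proof.
apply: semialgebraic_ext (semialgebraic_basic [:: q] [::] [::]) => x.
by rewrite /basic_semialgebraic /= !andbT.
Qed.

Lemma semialgebraic_gt0 q : semialgebraic [set x | 0 < mpoly.meval (x 0) q].
Proof.
apply: semialgebraic_ext (semialgebraic_basic [::] [:: q] [::]) => x.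
by rewrite /basic_semialgebraic /= !andbT.
Qed.

Lemma semialgebraic_ge0 q : semialgebraic [set x | 0 <= mpoly.meval (x 0) q].
Proof.
apply: semialgebraic_ext (semialgebraic_basic [::] [::] [:: q]) => x.
by rewrite /basic_semialgebraic /= !andbT.
Qed.

Lemma semialgebraic_set0 : semialgebraic (set0 : set 'rV[R]_m).
Proof.
apply: semialgebraic_ext (semialgebraic_zero 1) => x /=.
by rewrite mpoly.meval1 oner_eq0.
Qed.

Lemma semialgebraic_setT : semialgebraic (setT : set 'rV[R]_m).
Proof.
apply: semialgebraic_ext (semialgebraic_zero 0) => x /=.
by rewrite mpoly.meval0 eqxx.
Qed.

Lemma semialgebraic_bigcup (I : finType) (D : set I) (F : I -> set 'rV[R]_m) :
  (forall i, semialgebraic (F i)) -> semialgebraic (\bigcup_(i in D) F i).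
Proof.
move=> sF; have -> : D = [set` [pred i | i \in D]].
  by apply/seteqP; split=> i /=; rewrite inE.
rewrite bigcup_pred.
by apply: big_ind => //; [exact: semialgebraic_set0 | exact: semialgebraic_setU].
Qed.

End SemialgebraicSets.

(** * Sets defined by first-order formulas *)

Section FirstOrder.
Variable R : realType.

(** The valuation at which a formula in the variables [0, ..., m - 1] is
    evaluated. *)
Definition coords (m : nat) (x : 'rV[R]_m) : seq R := mktuple (x 0).

Lemma size_coords m (x : 'rV[R]_m) : size (coords x) = m.
Proof. exact: size_tuple. Qed.

Lemma nth_coords m (x : 'rV[R]_m) (i : 'I_m) : (coords x)`_i = x 0 i.
Proof. by rewrite /coords -tnth_nth tnth_mktuple. Qed.

(** Variables of index at least [m] lie outside the valuation, where [nth] gives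
    0; the zero polynomial represents them. *)
Lemma rterm_mpoly m (t : GRing.term R) : GRing.rterm t ->
  exists q : mpoly.mpoly m R,
    forall x : 'rV[R]_m, GRing.eval (coords x) t = mpoly.meval (x 0) q.
Proof.
elim: t => //=.
- move=> k _; have [ltkm|lemk] := ltnP k m.
    exists (mpoly.mpolyX R (mpoly.mnm1 (Ordinal ltkm))) => x.
    by rewrite mpoly.mevalXU -nth_coords.
  by exists 0 => x; rewrite mpoly.meval0 nth_default ?size_coords.
- by move=> c _; exists (mpoly.mpolyC m c) => x; rewrite mpoly.mevalC.
- by move=> k _; exists k%:R => x; rewrite rmorph_nat.
- move=> t IHt u IHu /andP[/IHt[p pE] /IHu[q qE]]; exists (p + q) => x.
  by rewrite pE qE mpoly.mevalD.
- by move=> t IHt /IHt[p pE]; exists (- p) => x; rewrite pE mpoly.mevalN.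
- by move=> t IHt k /IHt[p pE]; exists (p *+ k) => x; rewrite pE mpoly.mevalMn.
- move=> t IHt u IHu /andP[/IHt[p pE] /IHu[q qE]]; exists (p * q) => x.
  by rewrite pE qE mpoly.mevalM.
- by move=> t IHt k /IHt[p pE]; exists (p ^+ k) => x; rewrite pE rmorphXn.
Qed.

(** Semi-algebraic sets are generated by unions and intersections only, so
    negation has to be pushed down to the atoms: the induction treats a formula
    and its negation at the same time. *)
Lemma semialgebraic_qf m (f : ord.formula R) : ord.qf_form f -> ord.rformula f ->
  semialgebraic [set x : 'rV[R]_m | ord.qf_eval (coords x) f] /\
  semialgebraic [set x : 'rV[R]_m | ~~ ord.qf_eval (coords x) f].
Proof.
have s0 := @semialgebraic_set0 R m; have sT := @semialgebraic_setT R m.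
elim: f => //=.
- by case=> _ _; split; [apply: semialgebraic_ext sT|apply: semialgebraic_ext s0
    |apply: semialgebraic_ext s0|apply: semialgebraic_ext sT].
- move=> t u _ /andP[/rterm_mpoly-/(_ m)[p pE] /rterm_mpoly-/(_ m)[q qE]]; split.
    apply: semialgebraic_ext (semialgebraic_zero (p - q)) => x /=.
    by rewrite pE qE mpoly.mevalB subr_eq0.
  apply: semialgebraic_ext (semialgebraic_setU (semialgebraic_gt0 (p - q))
    (semialgebraic_gt0 (q - p))) => x /=.
  by rewrite pE qE !mpoly.mevalB !subr_gt0 neq_lt orbC; split=> /orP.
- move=> t u _ /andP[/rterm_mpoly-/(_ m)[p pE] /rterm_mpoly-/(_ m)[q qE]]; split.
    apply: semialgebraic_ext (semialgebraic_gt0 (q - p)) => x /=.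
    by rewrite pE qE mpoly.mevalB subr_gt0.
  apply: semialgebraic_ext (semialgebraic_ge0 (p - q)) => x /=.
  by rewrite pE qE mpoly.mevalB subr_ge0 leNgt.
- move=> t u _ /andP[/rterm_mpoly-/(_ m)[p pE] /rterm_mpoly-/(_ m)[q qE]]; split.
    apply: semialgebraic_ext (semialgebraic_ge0 (q - p)) => x /=.
    by rewrite pE qE mpoly.mevalB subr_ge0.
  apply: semialgebraic_ext (semialgebraic_gt0 (p - q)) => x /=.
  by rewrite pE qE mpoly.mevalB subr_gt0 ltNge.
- move=> f IHf g IHg /andP[qf qg] /andP[rf rg].
  have [sf snf] := IHf qf rf; have [sg sng] := IHg qg rg; split.
    apply: semialgebraic_ext (semialgebraic_setI sf sg) => x /=.
    by split=> /andP.
  apply: semialgebraic_ext (semialgebraic_setU snf sng) => x /=.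
  by rewrite negb_and; split=> /orP.
- move=> f IHf g IHg /andP[qf qg] /andP[rf rg].
  have [sf snf] := IHf qf rf; have [sg sng] := IHg qg rg; split.
    apply: semialgebraic_ext (semialgebraic_setU sf sg) => x /=.
    by split=> /orP.
  apply: semialgebraic_ext (semialgebraic_setI snf sng) => x /=.
  by rewrite negb_or; split=> /andP.
- move=> f IHf g IHg /andP[qf qg] /andP[rf rg].
  have [sf snf] := IHf qf rf; have [sg sng] := IHg qg rg; split.
    apply: semialgebraic_ext (semialgebraic_setU snf sg) => x /=.
    by rewrite implybE; split=> /orP.
  apply: semialgebraic_ext (semialgebraic_setI sf sng) => x /=.
  by rewrite negb_imply; split=> /andP.
- move=> f IHf qf rf; have [sf snf] := IHf qf rf; split=> //.
  by apply: semialgebraic_ext sf => x /=; rewrite negbK.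
Qed.

(** The Tarski-Seidenberg theorem, through quantifier elimination over a real
    closed field. *)
Lemma semialgebraic_holds m (f : ord.formula R) :
  semialgebraic [set x : 'rV[R]_m | ord.holds (coords x) f].
Proof.
have rf := ord.to_rform_rformula f.
have wf := @qe_rcf.wf_QE_wproj R; have valid := @qe_rcf.valid_QE_wproj R.
have /andP[qg rg] := ord.quantifier_elim_wf wf rf.
have [sg _] := @semialgebraic_qf m _ qg rg.
apply: semialgebraic_ext sg => x /=.
split=> [/(ord.quantifier_elim_rformP wf valid _ rf)/ord.to_rformP //|].
by move=> /ord.to_rformP/(ord.quantifier_elim_rformP wf valid _ rf).
Qed.

Lemma holds_bigAnd (I : finType) (e : seq R) (F : I -> ord.formula R) :
  ord.holds e (\big[@ord.And R/ord.Bool true]_(i : I) F i) <->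
  forall i, ord.holds e (F i).
Proof.
suff H (r : seq I) : ord.holds e (\big[@ord.And R/ord.Bool true]_(i <- r) F i) <->
    {in r, forall i, ord.holds e (F i)}.
  split=> [/H Fr i|Fr]; first by apply: Fr; rewrite mem_index_enum.
  by apply/H => i _.
elim: r => [|i r IHr]; first by rewrite big_nil; split.
rewrite big_cons /=; split=> [[Fi /IHr Fr] j|Fr].
  by rewrite inE => /predU1P[->|/Fr].
split; first by apply: Fr; rewrite mem_head.
by apply/IHr => j jr; apply: Fr; rewrite inE jr orbT.
Qed.

Lemma eval_bigAdd (I : finType) (e : seq R) (F : I -> GRing.term R) :
  GRing.eval e (\big[GRing.Add/GRing.NatConst R 0]_(i : I) F i) =
  \sum_i GRing.eval e (F i).
Proof. exact: (big_morph (GRing.eval e)). Qed.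

(** Quantifying the first [k] variables that follow a valuation amounts to
    quantifying over a vector: each quantifier appends one value. *)
Lemma holds_exists k (e : seq R) (f : ord.formula R) :
  ord.holds e (foldr (@ord.Exists R) f (iota (size e) k)) <->
  exists y : 'rV[R]_k, ord.holds (e ++ coords y) f.
Proof.
suff H : ord.holds e (foldr (@ord.Exists R) f (iota (size e) k)) <->
    exists2 v : seq R, size v = k & ord.holds (e ++ v) f.
  split=> [/H[v sv fv]|[y fy]]; last by apply/H; exists (coords y); rewrite ?size_coords.
  exists (\row_i v`_i); suff -> : coords (\row_(i < k) v`_i) = v by [].
  apply: (@eq_from_nth _ 0); rewrite size_coords // => i ik.
  by rewrite (nth_coords _ (Ordinal ik)) mxE.
have set_nth_end (u : seq R) x : set_nth 0 u (size u) x = rcons u x.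
  by rewrite set_nthE ltnn subnn cats1.
elim: k e => [|k IHk] e /=.
  split=> [fe|[v /size0nil ->]]; last by rewrite cats0.
  by exists [::]; rewrite ?cats0.
split=> [[x]|[[//|x v] [sv]]].
  rewrite set_nth_end -(size_rcons e x) => /IHk[v sv].
  by rewrite cat_rcons => fv; exists (x :: v); rewrite //= sv.
move=> fv; exists x; rewrite set_nth_end -(size_rcons e x).
by apply/IHk; exists v; rewrite ?cat_rcons.
Qed.

End FirstOrder.

(** * Sets of signed powers *)

Section Sigma.
Variables (R : realType) (n m : nat) (Y : 'M[R]_(m, n)).
Variables (p : rat) (a0 : 'rV[R]_m).
Hypothesis p_gt0 : 0 < p.

Lemma DeltaP (a : 'rV[R]_m) :
  Delta Y a0 a <-> Y^T *m (a - a0)^T = 0 /\ positive_orthant a.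
Proof.
split=> [[[w Yw <-] pos]|[Ya pos]]; first by rewrite addrC addKr.
by split=> //; exists (a - a0) => //; rewrite addrC subrK.
Qed.

Lemma pos_rat_nat_frac : exists r s : nat,
  (0 < s)%N /\ ratr p = r%:R / s%:R :> R.
Proof.
exists `|numq p|%N, `|denq p|%N; rewrite absz_gt0 denq_neq0; split=> //.
rewrite !natr_absz !gtr0_norm ?denq_gt0 ?numq_gt0 //.
Qed.

Lemma powR_frac (a : R) (r s : nat) : 0 <= a ->
  a `^ (r%:R / s%:R) = (a `^ s%:R^-1) ^+ r.
Proof. by move=> a0'; rewrite mulrC powRrM powR_mulrn ?powR_ge0. Qed.

(** The vector [y] of [s]-th roots of a point [a] of [Delta] turns the
    non-polynomial relation [b = a ^ p] into polynomial ones. *)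
Lemma sign_act_Delta_powP (r s : nat) (t : 'rV['Z_2]_m) (x : 'rV[R]_m) :
  (0 < s)%N -> ratr p = r%:R / s%:R :> R ->
  (exists2 b, Delta_pow Y p a0 b & sign_act t b = x) <->
  exists y : 'rV[R]_m,
    (forall i, 0 < y 0 i /\ x 0 i = (-1) ^+ (t 0 i : nat) * y 0 i ^+ r) /\
    (forall j, \sum_i Y i j * (y 0 i ^+ s - a0 0 i) = 0).
Proof.
move=> s_gt0 pE; have s_neq0 : s%:R != 0 :> R by rewrite pnatr_eq0 -lt0n.
have linE (a : 'rV[R]_m) : Y^T *m (a - a0)^T = 0 <->
    forall j, \sum_i Y i j * (a 0 i - a0 0 i) = 0.
  split=> [/matrixP Ya j|Ya]; last first.
    apply/matrixP=> j k; rewrite mxE [RHS]mxE -[RHS](Ya j).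
    by apply: eq_bigr => i _; rewrite !mxE (ord1 k).
  have := Ya j 0; rewrite mxE [RHS]mxE => Yj; rewrite -[RHS]Yj.
  by apply: eq_bigr => i _; rewrite !mxE.
split=> [[_ [a /DeltaP[/linE Ya apos] <-] <-]|[y [ypos Yy]]].
  exists (\row_i (a 0 i `^ s%:R^-1)); split=> [i|j].
    by rewrite !mxE powR_gt0 // pE powR_frac // ltW.
  rewrite -[RHS](Ya j); apply: eq_bigr => i _; rewrite !mxE.
  by rewrite -powR_mulrn ?powR_ge0 // -powRrM mulVf // powRr1 // ltW.
pose a : 'rV[R]_m := \row_i (y 0 i ^+ s).
exists (row_pow p a).
  exists a => //; apply/DeltaP; split; last first.
    by move=> i; rewrite mxE exprn_gt0 //; case: (ypos i).
  by apply/linE => j; rewrite -[RHS](Yy j); apply: eq_bigr => i _; rewrite mxE.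
apply/rowP=> i; rewrite !mxE; have [yi ->] := ypos i; congr (_ * _).
rewrite pE powR_frac ?exprn_ge0 ?ltW // -(@powR_mulrn _ _ s) ?ltW //.
by rewrite -powRrM divff // powRr1 // ltW.
Qed.

Lemma semialgebraic_Sigma (T : set 'rV['Z_2]_m) :
  semialgebraic (Sigma T (Delta_pow Y p a0)).
Proof.
have [r [s [s_gt0 pE]]] := pos_rat_nat_frac.
suff sF t : semialgebraic [set x : 'rV[R]_m |
    exists2 b, Delta_pow Y p a0 b & sign_act t b = x].
  apply: semialgebraic_ext (semialgebraic_bigcup T sF) => x.
  by split=> [[t Tt [b Db <-]]|[t Tt [b Db <-]]]; exists t => //; exists b.
(* The variables 0, ..., m - 1 stand for x, and m, ..., 2m - 1 for the roots. *)
pose y i : GRing.term R := GRing.Var R (m + i)%N.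
pose f := ord.And
  (\big[@ord.And R/ord.Bool true]_(i < m) ord.And
     (ord.Lt (GRing.NatConst R 0) (y i))
     (ord.Equal (GRing.Var R i)
        (GRing.Mul (GRing.Const ((-1) ^+ (t 0 i : nat))) (GRing.Exp (y i) r))))
  (\big[@ord.And R/ord.Bool true]_(j < n) ord.Equal
     (\big[GRing.Add/GRing.NatConst R 0]_(i < m) GRing.Mul (GRing.Const (Y i j))
        (GRing.Add (GRing.Exp (y i) s) (GRing.Opp (GRing.Const (a0 0 i)))))
     (GRing.NatConst R 0)).
apply: semialgebraic_ext
  (semialgebraic_holds m (foldr (@ord.Exists R) f (iota m m))) => x /=.
rewrite (sign_act_Delta_powP t x s_gt0 pE).
rewrite -[X in iota X](size_coords x) holds_exists.
suff fE v : ord.holds (coords x ++ coords v) f <->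
    (forall i, 0 < v 0 i /\ x 0 i = (-1) ^+ (t 0 i : nat) * v 0 i ^+ r) /\
    (forall j, \sum_i Y i j * (v 0 i ^+ s - a0 0 i) = 0).
  by split=> -[v /fE fv]; exists v.
have xE (i : 'I_m) : (coords x ++ coords v)`_i = x 0 i.
  by rewrite nth_cat size_coords ltn_ord nth_coords.
have yE (i : 'I_m) : (coords x ++ coords v)`_(m + i) = v 0 i.
  by rewrite nth_cat size_coords ltnNge leq_addr /= addKn nth_coords.
rewrite /f /= !holds_bigAnd.
have signE i : (0 < v 0 i /\ x 0 i = (-1) ^+ (t 0 i : nat) * v 0 i ^+ r) <->
    ord.holds (coords x ++ coords v) (ord.And
     (ord.Lt (GRing.NatConst R 0) (y i))
     (ord.Equal (GRing.Var R i)
        (GRing.Mul (GRing.Const ((-1) ^+ (t 0 i : nat))) (GRing.Exp (y i) r)))).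
  by rewrite /= xE yE.
have linE j : GRing.eval (coords x ++ coords v)
     (\big[GRing.Add/GRing.NatConst R 0]_(i < m) GRing.Mul (GRing.Const (Y i j))
        (GRing.Add (GRing.Exp (y i) s) (GRing.Opp (GRing.Const (a0 0 i))))) =
    \sum_i Y i j * (v 0 i ^+ s - a0 0 i).
  by rewrite eval_bigAdd; apply: eq_bigr => i _ /=; rewrite yE.
split=> -[Hx Hy]; split=> [i|j].
- exact/signE.
- by rewrite -linE; exact: Hy.
- exact/signE.
- by rewrite /= linE; exact: Hy.
Qed.

(** A vector [v] with [Y v = 1] certifies that the coordinate sum is constant
    on the affine space [a0 + Null Y^T]. *)
Lemma Delta_le_sum (a : 'rV[R]_m) (v : 'cV[R]_n) : Y *m v = const_mx 1 ->
  Delta Y a0 a -> forall i, a 0 i <= \sum_k a0 0 k.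
Proof.
move=> Yv /DeltaP[Ya apos] i.
have : (a - a0) *m (Y *m v) = 0.
  by rewrite mulmxA -[(a - a0) *m Y]trmxK trmx_mul Ya trmx0 mul0mx.
rewrite Yv => /matrixP/(_ 0 0); rewrite !mxE.
under eq_bigr do rewrite !mxE mulr1.
rewrite sumrB => /eqP; rewrite subr_eq0 => /eqP <-.
by rewrite (bigD1 i) //= lerDl sumr_ge0 // => k _; apply/ltW/apos.
Qed.

Lemma compact_closure_Sigma (T : set 'rV['Z_2]_m) (v : 'cV[R]_n) :
  Y *m v = const_mx 1 -> compact (closure (Sigma T (Delta_pow Y p a0))).
Proof.
move=> Yv; pose M : R := (\sum_k a0 0 k) `^ ratr p.
pose box : set 'rV[R]_m := [set x | forall i, `[- M, M]%classic (x ord0 i)].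
have box_compact : compact box.
  apply: (@rV_compact R m (fun=> `[- M, M]%classic)) => _.
  exact: segment_compact.
have box_closed : closed box.
  have -> : box = \bigcap_i ((fun x : 'rV[R]_m => x ord0 i) @^-1` `[- M, M]%classic).
    by apply/seteqP; split=> x bx i; [move=> _; exact: bx | exact: bx].
  apply: closed_bigI => i _; apply: preimage_closed; last exact: itv_closed.
  by move=> x _; exact: coord_continuous.
apply: (subclosed_compact _ box_compact); first exact: closed_closure.
rewrite closureE; apply: smallest_sub => // _ [t _ [_ [a Da <-] <-]] i /=.
have [_ apos] := (DeltaP a).1 Da.
rewrite in_itv /= -ler_norml !mxE normrM normrX normrN1 expr1n mul1r.
have aM := Delta_le_sum Yv Da i.
rewrite ger0_norm ?powR_ge0 // ge0_ler_powR ?ler0q ?nnegrE //; try exact: ltW.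
exact: le_trans (ltW (apos i)) aM.
Qed.

End Sigma.

(** * Root matrices *)

Lemma root_vector_sum (R : realType) (n : nat) (t : 'I_n * 'I_n * 'I_n) :
  root_vector R t *m const_mx 1 = (const_mx 1 : 'M[R]_1).
Proof. by rewrite mulmxBl mulmxDl -!rowE !row_const addrK. Qed.

Lemma root_matrix_row_sum (R : realType) (n : nat)
    (ord : seq ('I_n * 'I_n * 'I_n)) (Lambda : {set 'I_n * 'I_n * 'I_n}) :
  is_ordering ord -> Lambda \subset Theta n ->
  root_matrix R #|Lambda| ord Lambda *m const_mx 1 = const_mx 1 :> 'cV[R]_ _.
Proof.
move=> [uord ordE] LT; apply/row_matrixP => i.
rewrite row_mul rowK row_const.
(* The list of root vectors has exactly #|Lambda| entries, so that row i is one
   of them and not the default value of nth, whose entries sum to 0. *)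
set s := map _ _; suff /mapP[t _ ->] : nth 0 s i \in s by exact: root_vector_sum.
apply: mem_nth; rewrite size_map -(card_uniqP (filter_uniq _ uord)).
rewrite (@eq_card _ _ Lambda) // => t; rewrite mem_filter ordE.
by apply: andb_idr; exact: (fintype.subsetP LT).
Qed.

Theorem theorem2p5 (R : realType) (n m : nat)
  (ord : seq ('I_n * 'I_n * 'I_n)) (hord : is_ordering ord)
  (Lambda : {set 'I_n * 'I_n * 'I_n})
  (hLambda : Lambda \subset Theta n) (hcard : #|Lambda| = m) (hm : (0 < m)%N)
  (T : set 'rV['Z_2]_m) (p : rat) (hp : 0 < p)
  (a0 : 'rV[R]_m) (ha0 : positive_orthant a0) :
  let Y : 'M[R]_(m, n) := root_matrix R m ord Lambda in
  let S := Sigma T (Delta_pow Y p a0) in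
  semialgebraic S /\ compact (closure S).
Proof.
move=> Y S; split; first exact: semialgebraic_Sigma.
apply: (@compact_closure_Sigma R n m Y p a0 hp T (const_mx 1)).
by rewrite /Y; subst m; exact: root_matrix_row_sum.
Qed.
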